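(* Let $L'$ be the Laplacian matrix of the Grassmann graph $\Gamma'$ on the $2$-dimensional subspaces of $V=\mathbb F_q^n$, where $n\ge4$ and $q=p^t$. Then $L'$ has no nontrivial $p$-elementary divisors; that is, $p$ does not divide the order of the critical group $K(\Gamma')$.
   Context: Let $p$ be a prime, $q=p^t$ with $t\ge1$, $n\ge4$, and $V$ an $n$-dimensional vector space over $\mathbb F_q$. The Grassmann graph $\Gamma'$ has as vertices the $2$-dimensional subspaces of $V$, two distinct ones being adjacent when their intersection is nonzero. If $A'$ is its adjacency matrix and $k'$ its valency, $L'=k'I-A'$. The critical group $K(\Gamma')$ is the torsion subgroup of the cokernel of $L'$ viewed as an endomorphism of the free abelian group on the vertices. *)

(* Defs.v *)
From HB Require Import structures.
From mathcomp Require Import all_boot all_order all_algebra finmap.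
From mathcomp Require Import boolp classical_sets cardinality.

Set Implicit Arguments.
Unset Strict Implicit.
Unset Printing Implicit Defensive.

Import GRing.Theory.
Local Open Scope ring_scope.

Section RegularGraph.
Variables (T : finType) (e : rel T).

(* The maximum is only a means of selecting the common degree of a regular
   graph; see [grassmann_regular] for the graph considered below. *)
Definition valency : nat := \max_(x : T) #|[set y | e x y]|.

Definition adjacency : 'M[int]_#|T| :=
  \matrix_(i, j) (e (enum_val i) (enum_val j))%:R.

Definition laplacian : 'M[int]_#|T| := (valency%:R)%:M - adjacency.

End RegularGraph.

Section Cokernel.
Variables (m n : nat) (M : 'M[int]_(m, n)).

(* Integer matrices act on column vectors, so M : Z^n -> Z^m.  Membership in
   the image is made boolean classically, as the quotient construction needs. *)
Definition im_mx : {pred 'cV[int]_m} := fun x => `[< exists y, x = M *m y >].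

Fact im_mx_zmod_closed : zmod_closed im_mx.
Proof.
split; first by apply/asboolP; exists 0; rewrite mulmx0.
move=> x y /asboolP[u ->] /asboolP[v ->].
by apply/asboolP; exists (u - v); rewrite mulmxBr.
Qed.

HB.instance Definition _ :=
  GRing.isZmodClosed.Build 'cV[int]_m im_mx im_mx_zmod_closed.

Definition coker : zmodType := Quotient.quot im_mx.

End Cokernel.

Section Torsion.
Variable A : zmodType.

Definition torsion_pred : {pred A} :=
  fun x => `[< exists2 k : nat, (0 < k)%N & x *+ k = 0 >].

Fact torsion_zmod_closed : zmod_closed torsion_pred.
Proof.
split; first by apply/asboolP; exists 1%N.
move=> x y /asboolP[k k0 kx] /asboolP[l l0 ly].
apply/asboolP; exists (k * l)%N; first by rewrite muln_gt0 k0.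
by rewrite mulrnBl mulrnA kx mul0rn mulnC mulrnA ly mul0rn subr0.
Qed.

HB.instance Definition _ :=
  GRing.isZmodClosed.Build A torsion_pred torsion_zmod_closed.

Record torsion := Torsion { tval : A; _ : tval \in torsion_pred }.

HB.instance Definition _ := [isSub for tval].
HB.instance Definition _ := [Choice of torsion by <:].
HB.instance Definition _ := [SubChoice_isSubZmodule of torsion by <:].

End Torsion.

Definition critical_group (T : finType) (e : rel T) : zmodType :=
  torsion (coker (laplacian e)).

(* The order of a finite abelian group.  Junk value: 0 if A is infinite, so that
   "p does not divide [group_order A]" fails for infinite A. *)
Definition group_order (A : zmodType) : nat :=
  #|` fset_set [set: A]%classic |%fset.

Section ElementaryDivisors.
Variables (m n : nat).

(* The size condition excludes entries of d that do not occur in the matrix. *)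
Definition smith_form (M : 'M[int]_(m, n)) (d : seq int) : Prop :=
  [/\ size d = minn m n, sorted dvdz d &
      exists L R, [/\ L \in unitmx, R \in unitmx &
        M = L *m (\matrix_(i, j) (d`_i *+ (i == j :> nat))) *m R]].

(* e is one of the prime powers contributed by p to the torsion of the
   cokernel; it may be p ^ 0 = 1, which is the trivial one. *)
Definition p_elementary_divisor (p : nat) (M : 'M[int]_(m, n)) (e : nat) :=
  exists (d : seq int) (a : int),
    [/\ smith_form M d, a \in d, a != 0 & e = (p ^ logn p `|a|)%N].

Lemma smith_form_exists (M : 'M[int]_(m, n)) : exists d, smith_form M d.
Proof.
have [L uL [R uR [d d_sorted ->]]] := int_Smith_normal_form M.
pose d' := mkseq (fun i => d`_i) (minn m n); exists d'.
have dvd_nth i j : (i <= j)%N -> (d`_i %| d`_j)%Z.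
  move=> le_ij; have [lt_jd|le_dj] := ltnP j (size d); last first.
    by rewrite [d`_j]nth_default // dvdz0.
  apply: (sorted_leq_nth dvdz_trans dvdzz 0 d_sorted) => //.
  by rewrite inE (leq_ltn_trans le_ij).
split; first by rewrite size_mkseq.
  apply/(sortedP 0) => i; rewrite size_mkseq => lt_i.
  by rewrite !nth_mkseq ?(ltnW lt_i) //; apply: dvd_nth.
exists L, R; split=> //; congr (_ *m _ *m _); apply/matrixP => i j; rewrite !mxE.
have [eq_ij|] := eqVneq (i : nat) j; last by rewrite !mulr0n.
by rewrite nth_mkseq // leq_min ltn_ord eq_ij ltn_ord.
Qed.

End ElementaryDivisors.

Section Grassmann.
Variables (F : finFieldType) (V : vectType F).

Record plane := Plane { plane_val :> {vspace V}; _ : \dim plane_val == 2 }.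

HB.instance Definition _ := [isSub for plane_val].
HB.instance Definition _ := [Choice of plane by <:].

Let plane_mx (U : plane) : 'M[F]_(dim V) := VectorInternalTheory.vs2mx U.
Let mx_plane (A : 'M[F]_(dim V)) : option plane :=
  insub (VectorInternalTheory.mx2vs A).

Fact plane_mxK : pcancel plane_mx mx_plane.
Proof.
by move=> U; rewrite /mx_plane /plane_mx VectorInternalTheory.vs2mxK valK.
Qed.

HB.instance Definition _ := PCanIsCountable plane_mxK.
HB.instance Definition _ := isFinite.Build plane (pcan_enumP plane_mxK).

Definition grassmann : rel plane :=
  fun U W => (U != W) && (U :&: W != 0)%VS.

Lemma vspace_transitive (U W : {vspace V}) : \dim U = \dim W ->
  exists2 f : 'End(V), lker f == 0%VS & (f @: U)%VS = W.
Proof.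
move=> eq_dim; pose B (X : {vspace V}) := vbasis X ++ vbasis (X^C)%VS.
have basisB X : basis_of fullv (B X).
  rewrite -(addv_complf X); apply: cat_basis; try exact: vbasisP.
  by apply/directv_addP; rewrite capv_compl.
have sizeB : size (B W) = size (B U).
  by rewrite !size_cat !size_tuple !dimv_compl eq_dim.
have [f fP] := linear_of_free (B U) (B W).
have {}fP : map (linfun f) (B U) = B W.
  rewrite -(fP (basis_free (basisB U)) sizeB).
  by apply/eq_map => u; rewrite lfunE.
have limf : limg (linfun f) = fullv.
  have := limg_span (linfun f) (B U).
  by rewrite fP (span_basis (basisB U)) (span_basis (basisB W)).
exists (linfun f).
  rewrite -dimv_eq0; have := limg_ker_dim (linfun f) fullv.
  by rewrite limf capfv => /(canRL (addnK _)); rewrite subnn => ->.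
have /span_basis <- := vbasisP U; rewrite limg_span.
move: fP; rewrite map_cat => /(congr1 (take (\dim U))).
rewrite take_size_cat ?size_map ?size_tuple //.
by rewrite take_size_cat ?size_tuple // => ->; apply: span_basis (vbasisP W).
Qed.

Lemma grassmann_regular (U : plane) :
  #|[set W | grassmann U W]| = valency grassmann.
Proof.
suff le_deg U1 U2 :
    (#|[set W | grassmann U1 W]| <= #|[set W | grassmann U2 W]|)%N.
  apply/eqP; rewrite eqn_leq (leq_bigmax U) andTb.
  by apply/bigmax_leqP => W _; apply: le_deg.
have [|f kf fU] := @vspace_transitive U1 U2.
  by rewrite (eqP (valP U1)) (eqP (valP U2)).
have dimf (W : plane) : \dim (f @: W)%VS == 2.
  by rewrite limg_dim_eq ?(valP W) // (eqP kf) capv0.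
pose g W := Plane (dimf W).
have g_inj : injective g.
  move=> W1 W2 /(congr1 val) /= eqW; apply: val_inj; apply/eqP.
  by rewrite eqEsubv -(limg_ker0 W1 W2 kf) -(limg_ker0 W2 W1 kf) eqW subvv.
have gU : g U1 = U2 by apply: val_inj.
rewrite -(card_imset _ g_inj); apply/subset_leq_card/fintype.subsetP => W'.
case/imsetP=> W; rewrite !inE /grassmann => /andP[neqUW capUW] ->.
rewrite -{1}gU (inj_eq g_inj) neqUW /= -fU -lker0_img_cap // -dimv_eq0.
by rewrite limg_dim_eq ?dimv_eq0 // (eqP kf) capv0.
Qed.

End Grassmann.

(* Main.v *)
Require Import Defs.
From mathcomp Require Import all_boot all_order all_algebra finfield finmap.
From mathcomp Require Import generic_quotient ring_quotient.
From mathcomp Require Import boolp classical_sets cardinality.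

(* Let C be the incidence matrix of planes and nonzero vectors.  Modulo p, a
   nonzero subspace has q^k - 1 = -1 nonzero vectors and every nonzero vector
   lies on 1 plane (mod p), so A' + I = - C C^T, C^T C = J and k' = 0.  Hence L' x = 0
   modulo p says x = - C (C^T x), and then C^T x and x are constant.  So L' has
   corank at most 1 modulo p; as L' kills the constant vector, exactly one
   invariant factor is 0 and all others are prime to p. *)

Set Implicit Arguments.
Unset Strict Implicit.
Unset Printing Implicit Defensive.

Import GRing.Theory Num.Theory.
Local Open Scope ring_scope.
Local Open Scope quotient_scope.

(** * Smith normal forms: torsion of cokernels, and corank one modulo a prime *)

Lemma group_order_bij (A : zmodType) (T : finType) (f : T -> A) :
  injective f -> (forall a, exists t, a = f t) -> group_order A = #|T|.
Proof.
move=> f_inj f_surj; rewrite /group_order.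
have -> : [set: A]%classic = [set` [fset f t | t in T]%fset]%classic.
  apply/seteqP; split=> // a _ /=; have [t ->] := f_surj a.
  by apply/imfsetP; exists t.
by rewrite set_fsetK card_imfset //= cardE.
Qed.

Section Cokernel.
Variables (n : nat) (L R : 'M[int]_n) (d : seq int).
Hypotheses (uL : L \in unitmx) (uR : R \in unitmx).
Let S : 'M[int]_n := \matrix_(i, j) (d`_i *+ (i == j :> nat)).
Let M := L *m S *m R.
(** Coordinates with respect to the columns of [L], in which the image of [M] is the product of the
    ideals generated by the [d_i]. *)
Let cls (x : 'cV[int]_n) : coker M := \pi_(coker M) (L *m x).

Lemma mul_smith_diag (x : 'cV[int]_n) i : (S *m x) i 0 = d`_i * x i 0.
Proof.
rewrite mxE (bigD1 i) //= mxE eqxx big1 ?addr0 // => j neq_ji.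
by rewrite mxE -[_ == _ :> nat]/(i == j) eq_sym (negPf neq_ji) mul0r.
Qed.

Lemma im_smithP (x : 'cV[int]_n) :
  reflect (forall i, (d`_i %| x i 0%R)%Z) (L *m x \in im_mx M).
Proof.
apply: (iffP (asboolP _)) => [[y]|dv_x].
  rewrite -!mulmxA => /(can_inj (mulKmx uL)) -> i.
  by rewrite mul_smith_diag dvdz_mulr.
(* Coordinatewise division gives the preimage; where [d_i = 0], divisibility forces [x_i = 0]. *)
exists (invmx R *m \col_i (x i 0%R %/ d`_i)%Z); rewrite -!mulmxA mulKVmx //.
congr (_ *m _); apply/colP => i; rewrite mul_smith_diag mxE mulrC.
by rewrite divzK.
Qed.

Lemma coker_class_eq x y :
  cls x = cls y <-> forall i, (d`_i %| x i 0%R - y i 0%R)%Z.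
Proof.
have dvP : (forall i, (d`_i %| x i 0%R - y i 0%R)%Z) <->
           (forall i, (d`_i %| (x - y)%R i 0%R)%Z).
  by split=> dv i; move: (dv i); rewrite !mxE.
rewrite dvP; split=> [/eqP|] => [eq_xy|dv].
  by apply/im_smithP; rewrite mulmxBr Quotient.idealrBE.
by apply/eqP; rewrite /cls -Quotient.idealrBE -mulmxBr; apply/im_smithP.
Qed.

Lemma coker_class_surj z : exists x, z = cls x.
Proof. by exists (invmx L *m repr z); rewrite /cls mulKVmx // reprK. Qed.

(** Coordinates with [d_i = 0] span the free part; the product of the nonzero [|d_i|] annihilates
    all the others. *)
Lemma coker_class_torsion x :
  cls x \in @torsion_pred (coker M) <-> forall i : 'I_n, d`_i = 0 -> x i 0 = 0.
Proof.
have clsMn k : cls x *+ k = cls (x *+ k).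
  by rewrite /cls raddfMn /= raddfMn.
have cls0 : 0 = cls 0 by rewrite /cls mulmx0 raddf0.
split=> [/asboolP[k k0]|x0].
  rewrite clsMn cls0 => /coker_class_eq dv i di0; move: (dv i).
  rewrite di0 dvd0z !mxE subr0 mulmxnE -mulr_natr mulf_eq0 => /orP[/eqP //|].
  by rewrite pnatr_eq0 -leqn0 leqNgt k0.
apply/asboolP; exists (\prod_(i < n | (d`_i != 0)%R) `|(d`_i)%R|)%N.
  by rewrite prodn_cond_gt0 // => i; rewrite absz_gt0.
rewrite clsMn cls0; apply/coker_class_eq => i; rewrite mulmxnE mxE subr0.
have [/x0->|di0] := eqVneq (d`_i) 0; first by rewrite mul0rn dvdz0.
by rewrite (bigD1 i) //= mulnC mulrnA -[X in (_ %| X)%Z]mulr_natr natz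
  dvdz_mull // dvdzE.
Qed.

(** The number of values of coordinate [i] on torsion classes: [|d_i|] residues, or only 0 when
    [d_i = 0]. *)
Let c (i : 'I_n) := if d`_i == 0 then 1%N else absz (d`_i).

(** Each torsion class has exactly one coordinate vector whose entry at [i] is a natural number
    below [c i]. *)
Lemma card_torsion_coker_diag :
  group_order (torsion (coker M)) = (\prod_(i < n | (d`_i != 0)%R) `|(d`_i)%R|)%N.
Proof.
pose I := {dffun forall i : 'I_n, 'I_(c i)}.
pose vec (f : I) : 'cV[int]_n := \col_i (f i : nat)%:Z.
have tors f : cls (vec f) \in @torsion_pred (coker M).
  apply/coker_class_torsion => i di0; rewrite mxE.
  by case: (f i) => k /=; rewrite /c di0 eqxx ltnS leqn0 => /eqP->.
rewrite (@group_order_bij _ I (fun f => Torsion (tors f))).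
- rewrite card_dep_ffun foldrE big_map big_enum [RHS]big_mkcond /=.
  by apply: eq_bigr => i _; rewrite card_ord /c; case: eqP.
- move=> f g /(congr1 val) /= /coker_class_eq eq_fg.
  apply/ffunP => i; apply/val_inj; move: (eq_fg i); rewrite !mxE /=.
  move: (nat_of_ord (f i)) (nat_of_ord (g i)) (ltn_ord (f i)) (ltn_ord (g i)).
  rewrite /c => k l; case: eqP => [_|_] lt_k lt_l.
    by move: lt_k lt_l; rewrite !ltnS !leqn0 => /eqP-> /eqP->.
  (* [d_i] may be negative, so remainders are taken modulo [|d_i|] before passing to natural
     numbers. *)
  rewrite -eqz_mod_dvd -[(k %% _)%Z]modz_abs -[(l %% _)%Z]modz_abs.
  rewrite !modz_nat eqz_nat => /eqP.
  by rewrite !modn_small.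
- move=> [z tz]; have [x def_z] := coker_class_surj z.
  have x0 : forall i : 'I_n, d`_i = 0 -> x i 0 = 0.
    by apply/coker_class_torsion; rewrite -def_z.
  (* Remainders are the canonical representatives; where [d_i = 0], torsion gives [x_i = 0]. *)
  have ltc i : (`|(x i 0%R %% d`_i)%Z| < c i)%N.
    rewrite /c; have [di0|di0] := eqVneq (d`_i) 0; first by rewrite x0 // di0.
    by rewrite -ltz_nat gez0_abs ?modz_ge0 // ltz_mod.
  exists [ffun i => Ordinal (ltc i)]; apply/val_inj; rewrite /= def_z.
  apply/coker_class_eq => i; rewrite !mxE ffunE /=.
  have [di0|di0] := eqVneq (d`_i) 0; first by rewrite x0 // di0.
  rewrite gez0_abs ?modz_ge0 // {1}(divz_eq (x i 0) (d`_i)) addrK.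
  exact: dvdz_mull.
Qed.
End Cokernel.

Lemma card_torsion_coker n (M : 'M[int]_n) d : smith_form M d ->
  group_order (torsion (coker M)) =
  (\prod_(i < n | (d`_i != 0)%R) `|(d`_i)%R|)%N.
Proof. by case=> _ _ [L [R [uL uR ->]]]; apply: card_torsion_coker_diag. Qed.

(* The vectors R^-1 e_i with p | d_i are independent in the kernel modulo p, so
   at most one d_i is divisible by p; the relation M y = 0 forces some d_i = 0. *)
Lemma smith_form_corank1 (p n : nat) (M : 'M[int]_n) d (y : 'cV[int]_n)
    (u : 'cV['F_p]_n) : prime p -> smith_form M d -> y != 0 -> M *m y = 0 ->
  (forall x : 'cV['F_p]_n, map_mx intr M *m x = 0 -> exists a, x = a *: u) ->
  forall i : 'I_n, d`_i != 0 -> ~~ (p %| `|(d`_i)%R|)%N.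
Proof.
move=> p_pr [_ _ [L [R [uL uR def_M]]]] y0 My0 ker_M i di0.
apply/negP => p_di; set Rp := map_mx (intr : int -> 'F_p) R.
have uRp : Rp \in unitmx.
  by rewrite unitmxE det_map_mx rmorph_unit // -unitmxE.
have ker_col (k : 'I_n) : (p %| `|(d`_k)%R|)%N ->
    exists a, delta_mx k 0 = a *: (Rp *m u).
  move=> p_dk; have [|a def_a] := ker_M (invmx Rp *m delta_mx k 0).
    rewrite def_M 2!map_mxM -!mulmxA mulKVmx //.
    rewrite [X in _ *m X](_ : _ = 0) ?mulmx0 //; apply/colP => j.
    rewrite -colE !mxE; have [jk|_] := eqVneq (j : nat) k; last by rewrite rmorph0.
    rewrite mulr1n jk; case/dvdnP: p_dk => m def_m.
    rewrite [d`_k]intEsign def_m rmorphM /= PoszM rmorphM /=.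
    by rewrite -!pmulrn pchar_Fp_0 // !mulr0.
  by exists a; rewrite scalemxAr -def_a mulKVmx.
have [j] : exists j, (R *m y) j 0 != 0.
  apply/existsP; rewrite -negb_forall; apply: contra y0 => /forallP Ry0.
  rewrite -(mulKmx uR y) (_ : R *m y = 0) ?mulmx0 //.
  by apply/colP => j; rewrite [RHS]mxE; apply/eqP.
move=> Ryj; have dj0 : d`_j = 0.
  move: My0; rewrite def_M -!mulmxA => /(canRL (mulKmx uL)); rewrite mulmx0.
  move=> /colP/(_ j)/eqP; rewrite mul_smith_diag [X in _ == X]mxE mulf_eq0.
  by rewrite (negPf Ryj) orbF => /eqP.
have neq_ij : i != j by apply: contraNneq di0 => ->; rewrite dj0.
have [a def_a] := ker_col i p_di.
have [|b def_b] := ker_col j; first by rewrite dj0 dvdn0.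
(* With [v = Rp *m u], the coordinates read [a v_i = 1], [a v_j = 0] and [b v_j = 1], which is
   impossible in a field. *)
have /colP/(_ i) := def_a; have /colP/(_ j) := def_a; have /colP/(_ j) := def_b.
rewrite !mxE !eqxx eq_sym (negPf neq_ij) /= => b1 a0 a1.
have /eqP := a0; rewrite eq_sym mulf_eq0 => /orP[] /eqP z0.
  by move/eqP: a1; rewrite z0 mul0r oner_eq0.
by move/eqP: b1; rewrite z0 mulr0 oner_eq0.
Qed.

(** * Counting planes through one or two vectors *)

Lemma card_vspace_vec (F : finFieldType) (V : vectType F) (U : {vspace V}) :
  #|[pred u : finvect_type V | u \in U]| = (#|F| ^ \dim U)%N.
Proof.
(* Destructing [V] lets its vector space structure be read on the finite carrier
   [finvect_type V]. *)
case: V U => T c U.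
exact: (@card_vspace F (finvect_type (Vector.Pack c)) c U).
Qed.

Section PlanesThroughVectors.
Variables (F : finFieldType) (V : vectType F).
Local Notation q := #|F|.
Local Notation vec := (finvect_type V).

Lemma dim_plane (U : plane V) : \dim (plane_val U) = 2%N.
Proof. by apply/eqP; case: U. Qed.

Lemma dim_span2 (u w : V) : u != 0 -> w \notin <[u]>%VS ->
  \dim (<[u]> + <[w]>)%VS == 2%N.
Proof.
move=> u0 wu; have w0 : w != 0 by apply: contraNneq wu => ->; apply: mem0v.
rewrite dimv_disjoint_sum ?dim_vline ?u0 ?w0 //.
apply/eqP; rewrite -subv0; apply/subvP => v; rewrite memv_cap => /andP[vu].
case/vlineP => a va; rewrite memv0; move: vu; rewrite va.
have [-> _|a0] := eqVneq a 0; first by rewrite scale0r.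
by move=> aw; case/negP: wu; rewrite -(scalerK a0 w) memvZ.
Qed.

Lemma card_plane_through2 (u w : V) : u != 0 -> w \notin <[u]>%VS ->
  #|[set U : plane V | (u \in plane_val U) && (w \in plane_val U)]| = 1%N.
Proof.
move=> u0 wu; apply/eqP/cards1P; exists (Plane (dim_span2 u0 wu)).
apply/setP => U; rewrite !inE; apply/andP/eqP => [[uU wU]|->] /=.
  apply/esym/val_inj/eqP; rewrite /= eqEdim (dim_plane U).
  by rewrite (eqP (dim_span2 u0 wu)) leqnn subv_add -!memvE uU wU.
by rewrite !memvE addvSl addvSr.
Qed.

(** Double count of the pairs of a plane [U] through [u] and a vector [w] of [U] off the line of
    [u]: each plane has [q^2 - q] such vectors, each [w] determines one plane, and a factor [q]
    cancels. *)
Lemma card_plane_through (u : V) : u != 0 -> (0 < \dim {:V})%N ->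
  (#|[set U : plane V | u \in plane_val U]| * (q - 1) = q ^ (\dim {:V}).-1 - 1)%N.
Proof.
move=> u0 dimV; have q1 : (1 < q)%N by apply: card_finNzRing_gt1.
have card_line : #|[pred w : vec | w \in <[u]>%VS]| = q.
  by rewrite card_vspace_vec dim_vline u0 expn1.
have card_off (U : {vspace V}) : u \in U ->
    (#|[pred w : vec | (w \in U) && (w \notin <[u]>%VS)]| = q ^ \dim U - q)%N.
  move=> uU; rewrite -card_vspace_vec 
    -(cardID [pred w : vec | w \in <[u]>%VS] [pred w : vec | w \in U]).
  rewrite [X in (X + _)%N](_ : _ = q) => [|]; last first.
    rewrite -card_line; apply: eq_card => w; rewrite !inE.
    rewrite andb_idl // => /vlineP[a ->]. exact: memvZ.
  by rewrite addKn; apply: eq_card => w; rewrite !inE andbC.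
have : (\sum_(U : plane V | u \in plane_val U)
          \sum_(w : vec | w \notin <[u]>%VS) (w \in plane_val U)
        = \sum_(w : vec | w \notin <[u]>%VS) 1)%N.
  rewrite exchange_big; apply: eq_bigr => w wu /=.
  rewrite -[RHS](card_plane_through2 u0 wu) -big_mkcondr sum1_card.
  by apply: eq_card => U; rewrite !inE.
rewrite sum1_card (eq_bigr (fun=> q ^ 2 - q)%N) => [|U uU]; last first.
  rewrite -(dim_plane U) -card_off // -big_mkcondr sum1_card.
  by apply: eq_card => w; rewrite !inE andbC.
have -> : #|[pred w : vec | w \notin <[u]>%VS]| = (q ^ \dim {:V} - q)%N.
  by rewrite -card_off ?memvf //; apply: eq_card => w; rewrite !inE memvf.
have powB k : (q ^ k.+1 - q = q * (q ^ k - 1))%N by rewrite expnS mulnBr muln1.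
rewrite sum_nat_const -{1}(prednK dimV) !powB expn1 mulnCA => /eqP.
rewrite eqn_pmul2l ?(ltnW q1) // => /eqP <-; congr (_ * _)%N.
by apply: eq_card => U; rewrite !inE.
Qed.

(** * Incidence identities over a ring in which [q = 0] *)

Section ModP.
Variable R : comNzRingType.
Hypotheses (q0 : q%:R = 0 :> R) (dimV : (1 < \dim {:V})%N).

(** The count [N] of planes satisfies [N * (-1) = -1] once [q = 0]; the power of [q] vanishes
    because its exponent [\dim {:V} - 1] is positive. *)
Lemma plane_through_natr (u : V) : u != 0 ->
  \sum_(U : plane V) (u \in plane_val U)%:R = 1 :> R.
Proof.
move=> u0; have q_gt0 : (0 < q)%N by apply: ltnW (card_finNzRing_gt1 F).
have /(congr1 (fun k => k%:R : R)) := card_plane_through u0 (ltnW dimV).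
rewrite natrM !natrB ?expn_gt0 ?q_gt0 // natrX q0 expr0n.
have -> : ((\dim {:V}).-1 == 0)%N = false by case: (\dim _) dimV => [|[]].
rewrite !sub0r mulrN1 => /oppr_inj cardU; rewrite -[RHS]cardU.
rewrite -natr_sum -big_mkcond -sum1_card; congr (_%:R).
by apply: eq_bigl => U; rewrite inE.
Qed.

(** The identity [C^T C = J]: independent vectors span a single plane, and proportional ones lie on
    the same planes, whose number is 1 in [R]. *)
Lemma plane_through2_natr (u w : V) : u != 0 -> w != 0 ->
  \sum_(U : plane V) (u \in plane_val U)%:R * (w \in plane_val U)%:R = 1 :> R.
Proof.
move=> u0 w0; have [/vlineP[a wa]|wu] := boolP (w \in <[u]>%VS).
  have a0 : a != 0 by apply: contraNneq w0 => a0; rewrite wa a0 scale0r.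
  rewrite -[RHS](plane_through_natr u0); apply: eq_bigr => U _.
  have -> : (w \in plane_val U) = (u \in plane_val U).
    rewrite wa; apply/idP/idP => [/(memvZ a^-1)|]; last exact: memvZ.
    by rewrite scalerK.
  by rewrite -natrM mulnb andbb.
rewrite -[RHS](congr1 (fun k => k%:R) (card_plane_through2 u0 wu)).
rewrite -sum1_card natr_sum [RHS]big_mkcond; apply: eq_bigr => U _; rewrite inE.
by rewrite -natrM mulnb; case: (_ && _).
Qed.

Lemma nonzero_vec_natr (U : {vspace V}) :
  \sum_(u : vec | u != 0) (u \in U)%:R = (q ^ \dim U)%:R - 1 :> R.
Proof.
have U0 : (0 : vec) \in U := mem0v U.
rewrite -card_vspace_vec (cardD1 (0 : vec)) inE U0 natrD addrAC subrr add0r.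
rewrite -natr_sum -big_mkcondr -sum1_card; congr (_%:R).
Qed.

Lemma nonzero_plane_natr (U : plane V) :
  \sum_(u : vec | u != 0) (u \in plane_val U)%:R = -1 :> R.
Proof. by rewrite nonzero_vec_natr (dim_plane U) natrX q0 expr0n sub0r. Qed.

(** The identity [A' + I = - C C^T]: the sum is [q^k - 1] with [k] the dimension of the
    intersection, hence 0 if [k = 0] and -1 otherwise. *)
Lemma grassmann_natr (U W : plane V) :
  (grassmann U W)%:R + (U == W)%:R =
  - \sum_(u : vec | u != 0) (u \in plane_val U)%:R * (u \in plane_val W)%:R :> R.
Proof.
rewrite (eq_bigr (fun u => (u \in (plane_val U :&: plane_val W)%VS)%:R)); last first.
  by move=> u _; rewrite memv_cap -natrM mulnb.
rewrite nonzero_vec_natr natrX q0 expr0n dimv_eq0 /grassmann opprB.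
have [<-|_] /= := eqVneq U W; last by case: eqP; rewrite /= addr0 ?subrr ?subr0.
by rewrite capvv -dimv_eq0 (dim_plane U) /= add0r subr0.
Qed.

(** Summing row [U] of [A' + I = - C C^T] gives [k' + 1 = 1]: each of the -1 nonzero vectors of [U]
    lies on 1 plane in [R]. *)
Lemma valency_natr (U : plane V) : (valency (@grassmann F V))%:R = 0 :> R.
Proof.
rewrite -(grassmann_regular U) -sum1_card natr_sum big_mkcond /=.
apply: (addIr 1); rewrite add0r.
transitivity (\sum_W ((grassmann U W)%:R + (U == W)%:R : R)).
  rewrite big_split /=; congr (_ + _).
    by apply: eq_bigr => W _; rewrite inE; case: (grassmann _ _).
  rewrite (bigD1 U) //= eqxx big1 ?addr0 // => W.
  by rewrite eq_sym => /negPf->.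
rewrite (eq_bigr _ (fun W _ => grassmann_natr U W)) sumrN exchange_big /=.
rewrite (eq_bigr (fun u => (u \in plane_val U)%:R)) => [|u u0].
  by rewrite nonzero_plane_natr opprK.
by rewrite -mulr_sumr plane_through_natr // mulr1.
Qed.

Lemma harmonic_const (x : plane V -> R) :
    (forall U, (valency (@grassmann F V))%:R * x U
               = \sum_W (grassmann U W)%:R * x W) ->
  forall U W, x U = x W.
Proof.
(* [y] is [C^T x]; as [k' = 0], harmonicity becomes [x = - C y]. *)
move=> harm; pose y (u : vec) := \sum_(W : plane V) (u \in plane_val W)%:R * x W.
have xE U : x U = - \sum_(u : vec | u != 0) (u \in plane_val U)%:R * y u.
  transitivity (\sum_W ((grassmann U W)%:R + (U == W)%:R) * x W).
    rewrite (eq_bigr _ (fun W _ => mulrDl _ _ _)) big_split /= -harm.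
    rewrite (valency_natr U) mul0r add0r (bigD1 U) //= eqxx mul1r.
    by rewrite big1 ?addr0 // => W; rewrite eq_sym => /negPf->; rewrite mul0r.
  under eq_bigr do rewrite grassmann_natr mulNr mulr_suml.
  rewrite sumrN exchange_big; congr (- _); apply: eq_bigr => u _.
  by rewrite mulr_sumr; apply: eq_bigr => W _; rewrite mulrA.
(* Substituting [x = - C y] into [y = C^T x] gives [y = - J y], so [y] takes a single value on
   nonzero vectors. *)
pose c := - \sum_(w : vec | w != 0) y w.
have yE (u : vec) : u != 0 -> y u = c.
  move=> u0; rewrite {1}/y; under eq_bigr do rewrite xE mulrN mulr_sumr.
  rewrite sumrN exchange_big; congr (- _); apply: eq_bigr => w w0.
  under eq_bigr do rewrite mulrA.
  by rewrite -mulr_suml plane_through2_natr // mul1r.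
(* A plane has -1 nonzero vectors in [R], so the two signs cancel. *)
have xc U : x U = c.
  rewrite xE (eq_bigr _ (fun u u0 => congr1 _ (yE u u0))) -mulr_suml.
  by rewrite nonzero_plane_natr mulN1r opprK.
by move=> U W; rewrite !xc.
Qed.

End ModP.
End PlanesThroughVectors.

(** * The Laplacian of the Grassmann graph and its critical group *)

(** Replaces matrix indices by vertices; the ring is general because both the integers and ['F_p]
    occur. *)
Lemma mul_laplacian (R : comNzRingType) (T : finType) (e : rel T)
    (x : 'cV[R]_#|T|) (t : T) :
  (map_mx intr (laplacian e) *m x) (enum_rank t) 0 =
  (valency e)%:R * x (enum_rank t) 0 - \sum_s (e t s)%:R * x (enum_rank s) 0.
Proof.
rewrite /laplacian map_mxB map_scalar_mx mulmxBl mul_scalar_mx !mxE.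
rewrite rmorph_nat; congr (_ - _); rewrite (reindex enum_rank) /=.
  by apply: eq_bigr => s _; rewrite !mxE !enum_rankK rmorph_nat.
by exists enum_val => s _; [apply: enum_rankK | apply: enum_valK].
Qed.

(** Regularity puts the constant vector in the integral kernel, and [harmonic_const] shows that the
    kernel modulo [p] contains only constants, so [smith_form_corank1] applies. *)
Lemma grassmann_smith_form (p t : nat) (F : finFieldType) (V : vectType F) d :
    prime p -> (0 < t)%N -> #|F| = (p ^ t)%N -> (1 < \dim {:V})%N ->
    smith_form (laplacian (@grassmann F V)) d ->
  forall i : 'I_#|{: plane V}|, d`_i != 0 -> ~~ (p %| `|(d`_i)%R|)%N.
Proof.
move=> p_pr t_gt0 cardF dimV dM i.
pose y : 'cV[int]_#|{: plane V}| := const_mx 1.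
apply: (@smith_form_corank1 p _ _ d y (const_mx 1) p_pr dM).
- by apply/eqP => /colP/(_ i); rewrite !mxE.
- apply/colP => j; rewrite -(enum_valK j) [RHS]mxE.
  have := mul_laplacian (@grassmann F V) y (enum_val j).
  (* The cast from integers to integers is the identity, so the general formula speaks of the
     integral Laplacian. *)
  rewrite (_ : map_mx intr _ = laplacian (@grassmann F V)); last first.
    by apply/matrixP => k l; rewrite mxE intz.
  move=> ->; rewrite mxE mulr1 -(grassmann_regular (enum_val j)) -sum1_card.
  rewrite natr_sum big_mkcond -sumrB big1 // => W _.
  by rewrite inE mxE mulr1; case: (grassmann _ _); rewrite subrr.
move=> x Mx0; exists (x i 0); apply/colP => j; rewrite !mxE mulr1.
have q0 : #|F|%:R = 0 :> 'F_p.
  by rewrite cardF natrX pchar_Fp_0 // expr0n; case: t t_gt0 {cardF}.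
rewrite -(enum_valK i) -(enum_valK j).
apply: (harmonic_const q0 dimV (x := fun U => x (enum_rank U) 0)) => U.
by apply/eqP; rewrite -subr_eq0 -mul_laplacian Mx0 mxE.
Qed.

Theorem mainTheorem4 (p t n : nat) (F : finFieldType) (V : vectType F)
    (p_prime : prime p) (t_ge1 : (1 <= t)%N) (cardF : #|F| = (p ^ t)%N)
    (dimV : \dim {:V} = n) (n_ge4 : (4 <= n)%N) :
  (forall e : nat,
     p_elementary_divisor p (laplacian (@grassmann F V)) e -> e = 1%N) /\
  ~~ (p %| group_order (critical_group (@grassmann F V)))%N.
Proof.
have dimV_gt1 : (1 < \dim {:V})%N by rewrite dimV (leq_trans _ n_ge4).
have ndvd := @grassmann_smith_form p t F V _ p_prime t_ge1 cardF dimV_gt1.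
split=> [e [d [a [dM da a0 ->]]]|].
  have [size_d _ _] := dM; move: da; rewrite -index_mem size_d minnn => lt_i.
  have da : d`_(index a d) = a by rewrite nth_index // -index_mem size_d minnn.
  have := ndvd d dM (Ordinal lt_i); rewrite /= da => /(_ a0) p'a.
  (* The exponent of [p] in [a] is zero, and [p ^ 0 = 1]. *)
  by rewrite lognE p_prime (negPf p'a) !andbF.
have [d dM] := smith_form_exists (laplacian (@grassmann F V)).
(* The order is the product of the nonzero invariant factors, and a product of numbers prime to [p]
   is prime to [p]. *)
rewrite /critical_group (card_torsion_coker dM).
apply: (big_ind (fun k => ~~ (p %| k)%N)) => [|k l pk pl|i].
- by rewrite dvdn1 neq_ltn prime_gt1 ?orbT.
- by rewrite Euclid_dvdM // negb_or pk.
exact: ndvd.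
Qed.
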